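(* Let $\overline B$ be a graded connected unshuffle bialgebra over $k$ and $A$ a unital commutative $k$-algebra. For all $\gamma_1,\gamma_2\in g_B(A)$, $$\mathcal E_\prec(\gamma_1)*\mathcal E_\prec(\gamma_2^{\gamma_1})=\mathcal E_\prec(\gamma_1+\gamma_2)$$ and $$\mathcal E_\succ(\gamma_1^{-\gamma_2})*\mathcal E_\succ(\gamma_2)=\mathcal E_\succ(\gamma_1+\gamma_2),$$ where, for $\mu,\nu\in g_B(A)$, $\nu^{\mu}:=ad^\prec_\mu(\nu):=\mathcal E_\prec(\mu)^{-1}\succ\nu\prec\mathcal E_\prec(\mu)$ (so $\gamma_1^{-\gamma_2}=ad^\prec_{-\gamma_2}(\gamma_1)$).
   Context: $k$ is a field of characteristic zero. A graded connected unshuffle bialgebra is a graded unital counital bialgebra $\overline B=k\mathbf 1\oplus B$, $B=\bigoplus_{n\ge1}B_n$, with product $\cdot_B$ and coassociative coproduct $\Delta(c)=\bar\Delta(c)+c\otimes\mathbf 1+\mathbf 1\otimes c$ ($c\in B$), together with a splitting $\bar\Delta=\Delta_\prec+\Delta_\succ$ into graded linear maps $B\to B\otimes B$ such that $(\Delta_\prec\otimes\mathrm{id})\Delta_\prec=(\mathrm{id}\otimes\bar\Delta)\Delta_\prec$, $(\Delta_\succ\otimes\mathrm{id})\Delta_\prec=(\mathrm{id}\otimes\Delta_\prec)\Delta_\succ$, $(\bar\Delta\otimes\mathrm{id})\Delta_\succ=(\mathrm{id}\otimes\Delta_\succ)\Delta_\succ$, and, with $\Delta^+_\prec(a):=\Delta_\prec(a)+a\otimes\mathbf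 1$, $\Delta^+_\succ(a):=\Delta_\succ(a)+\mathbf 1\otimes a$, such that $\Delta^+_\prec(a\cdot_Bb)=\Delta^+_\prec(a)\cdot_B\Delta(b)$ and $\Delta^+_\succ(a\cdot_Bb)=\Delta^+_\succ(a)\cdot_B\Delta(b)$ for $a,b\in B$. For a unital commutative $k$-algebra $A$ with product $m_A$: $e:\overline B\to k\to A$ is the augmentation (unital on $k\mathbf 1$, zero on $B$); $f*g:=m_A(f\otimes g)\Delta$ for $f,g\in\mathrm{Lin}(\overline B,A)$, with unit $e$; $f\prec g:=m_A(f\otimes g)\Delta_\prec$ and $f\succ g:=m_A(f\otimes g)\Delta_\succ$ for $f,g\in\mathrm{Lin}(B,A)$ (viewed as the linear maps on $\overline B$ vanishing on $\mathbf 1$), extended bilinearly by $e\succ f=f=f\prec e$, $e\prec f=0=f\succ e$. The identity $(f\succ g)\prec h=f\succ(g\prec h)$ makes expressions $f\succ g\prec h$ unambiguous. $G_B(A)$ is the group (under $*$) of characters, i.e. unital algebra maps $\overline B\to A$; inverses are for $*$. $g_B(A)$ is the space of infinitesimal characters, i.e. linear $\kappa:\overline B\to A$ with $\kappa(\mathbf 1)=0$ and $\kappa(a\cdot_Bb)=0$ for $a,b\in B$. For $\alpha\in g_B(A)$: $\mathcal E_\prec(\alpha):=e+\sum_{n>0}\alpha^{\prec n}$ with $\alpha^{\prec 1}=\alpha$, $\alpha^{\prec n}=\alpha\prec\alpha^{\prec n-1}$, and $\mathcal E_\succ(\alpha):=e+\sum_{n>0}\alpha^{\succ n}$ with $\alpha^{\succ1}=\alpha$,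 $\alpha^{\succ n}=\alpha^{\succ n-1}\succ\alpha$; both are elements of $G_B(A)$. *)

(* Defs.v *)
From HB Require Import structures.
From mathcomp Require Import all_boot all_order all_algebra.
From mathcomp Require Import generic_quotient.
From mathcomp Require Import mathcomp_extra boolp classical_sets functions.
From mathcomp Require Import cardinality fsbigop.

Set Implicit Arguments.
Unset Strict Implicit.
Unset Printing Implicit Defensive.

Import GRing.Theory.
Local Open Scope classical_set_scope.
Local Open Scope ring_scope.
Local Open Scope quotient_scope.

(* The tensor product over a field k: finite formal sums of pairs, two of     *)
(* them being identified when every bilinear map takes the same value on      *)
(* both. The lemmas tensEDl, ..., tlift_unique show that the resulting module *)
(* is generated by pure tensors and has the usual universal property.         *)

Notation is_bilinear f := (bilinear_for *:%R *:%R f).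

Section TensorDef.
Context {k : fieldType} {V W : lmodType k}.

Definition bisum (U : lmodType k) (f : V -> W -> U) (s : seq (V * W)) : U :=
  \sum_(p <- s) f p.1 p.2.

Definition tensor_rel (s t : seq (V * W)) : bool :=
  `[< forall (U : lmodType k) (f : V -> W -> U),
        is_bilinear f -> bisum f s = bisum f t >].

Lemma tensor_relP : equiv_class_of tensor_rel.
Proof.
split=> [s|s t|t s u]; first exact/asboolP.
  by apply/asboolP/asboolP => st U f /st.
by move=> /asboolP st /asboolP tu; apply/asboolP => U f bf; rewrite st// tu.
Qed.

Canonical tensor_equiv := EquivRelPack tensor_relP.

End TensorDef.

Definition tensor (k : fieldType) (V W : lmodType k) : Type :=
  {eq_quot @tensor_rel k V W}.

Section Tensor.
Context {k : fieldType} {V W : lmodType k}.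
Local Notation T := (tensor V W).

HB.instance Definition _ := Choice.copy T {eq_quot @tensor_rel k V W}.
HB.instance Definition _ :=
  EqQuotient.copy T {eq_quot @tensor_rel k V W}.

Let cls (s : seq (V * W)) : T := \pi_T s.

Let clsP (s t : seq (V * W)) :
  (forall (U : lmodType k) (f : V -> W -> U),
     is_bilinear f -> bisum f s = bisum f t) -> cls s = cls t.
Proof. by move=> st; apply/eqmodP/asboolP. Qed.

Let bisum_repr (U : lmodType k) (f : V -> W -> U) s :
  is_bilinear f -> bisum f (repr (cls s)) = bisum f s.
Proof.
move=> bf; have /eqmodP/asboolP : cls (repr (cls s)) = cls s by rewrite /cls reprK.
exact.
Qed.

Let opps (s : seq (V * W)) := [seq (- p.1, p.2) | p <- s].
Let scales (c : k) (s : seq (V * W)) := [seq (c *: p.1, p.2) | p <- s].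

Let bisum_cat (U : lmodType k) (f : V -> W -> U) s t :
  bisum f (s ++ t) = bisum f s + bisum f t.
Proof. exact: big_cat. Qed.

Let bisum_scales (U : lmodType k) (f : V -> W -> U) c s :
  is_bilinear f -> bisum f (scales c s) = c *: bisum f s.
Proof.
case=> fl _; rewrite /bisum big_map scaler_sumr; apply: eq_bigr => p _ /=.
exact: (scalable_linear (fl p.2)).
Qed.

Let bisum_opps (U : lmodType k) (f : V -> W -> U) s :
  is_bilinear f -> bisum f (opps s) = - bisum f s.
Proof.
move=> bf; rewrite -[RHS]scaleN1r -bisum_scales//; congr (bisum f _).
by apply: eq_map => p; rewrite scaleN1r.
Qed.

Let tadd (x y : T) := cls (repr x ++ repr y).
Let topp (x : T) := cls (opps (repr x)).
Let tscale (c : k) (x : T) := cls (scales c (repr x)).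

Let bE := (bisum_repr, bisum_cat, bisum_scales, bisum_opps).

Let clsK (x : T) : cls (repr x) = x. Proof. exact: reprK. Qed.

Let taddA : associative tadd.
Proof. by move=> x y z; apply: clsP => U f bf; rewrite !bE// addrA. Qed.

Let taddC : commutative tadd.
Proof. by move=> x y; apply: clsP => U f bf; rewrite !bE// addrC. Qed.

Let tadd0 : left_id (cls [::]) tadd.
Proof.
move=> x; rewrite -[RHS]clsK; apply: clsP => U f bf; rewrite !bE//.
by rewrite {1}/bisum big_nil add0r.
Qed.

Let taddN : left_inverse (cls [::]) topp tadd.
Proof.
move=> x; apply: clsP => U f bf; rewrite !bE//.
by rewrite addNr /bisum big_nil.
Qed.

HB.instance Definition _ := GRing.isZmodule.Build T taddA taddC tadd0 taddN.

Let tscaleA a b (x : T) : tscale a (tscale b x) = tscale (a * b) x.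
Proof. by apply: clsP => U f bf; rewrite !bE// scalerA. Qed.

Let tscale1 : left_id 1 tscale.
Proof.
by move=> x; rewrite -[RHS]clsK; apply: clsP => U f bf; rewrite !bE// scale1r.
Qed.

Let tscaleDr : right_distributive tscale +%R.
Proof. by move=> a x y; apply: clsP => U f bf; rewrite !bE// scalerDr. Qed.

Let tscaleDl x : {morph tscale^~ x : a b / a + b}.
Proof. by move=> a b; apply: clsP => U f bf; rewrite !bE// scalerDl. Qed.

HB.instance Definition _ :=
  GRing.Zmodule_isLmodule.Build k T tscaleA tscale1 tscaleDr tscaleDl.

Definition tens (v : V) (w : W) : T := \pi_T [:: (v, w)].

(* The linear map induced by the bilinear map f; meaningful only if f is      *)
(* bilinear.                                                                  *)
Definition tlift (U : lmodType k) (f : V -> W -> U) (t : T) : U :=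
  bisum f (repr t).

Lemma tlift_linear (U : lmodType k) (f : V -> W -> U) :
  is_bilinear f -> linear (tlift f).
Proof. by move=> bf c x y; rewrite /tlift !bE. Qed.

Lemma tliftE (U : lmodType k) (f : V -> W -> U) v w :
  is_bilinear f -> tlift f (tens v w) = f v w.
Proof. by move=> bf; rewrite /tlift bisum_repr// /bisum big_seq1. Qed.

Lemma tens_bilinear : is_bilinear tens.
Proof.
split=> [w c v v'|v c w w'].
  apply: clsP => U f bf; rewrite !bE// /bisum !big_seq1 /=.
  exact: bf.1.
apply: clsP => U f bf; rewrite !bE// /bisum !big_seq1 /=.
exact: bf.2.
Qed.

Lemma tens_gen (t : T) : t = \sum_(p <- repr t) tens p.1 p.2.
Proof.
rewrite -[LHS]clsK; elim: (repr t) => [|p s IHs]; first by rewrite big_nil.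
rewrite big_cons -IHs; apply: clsP => U f bf; rewrite !bE//.
by rewrite /bisum big_cons big_seq1.
Qed.

Lemma tlift_unique (U : lmodType k) (f : V -> W -> U) (g : T -> U) :
  linear g -> (forall v w, g (tens v w) = f v w) -> g =1 tlift f.
Proof.
move=> lg gf t; rewrite {1}[t]tens_gen /tlift /bisum.
have g0 : g 0 = 0.
  by rewrite -[in LHS](subrr 0) (zmod_morphism_linear lg) subrr.
elim: (repr t) => [|p s IHs]; first by rewrite !big_nil.
by rewrite !big_cons -IHs -gf -[tens _ _ in LHS]scale1r lg scale1r.
Qed.

End Tensor.

Arguments tens : simpl never.
Notation "v ⊗ w" := (tens v w) (at level 40, left associativity) : ring_scope.

Section TensorOps.
Context {k : fieldType}.

Definition tmap (V W V' W' : lmodType k) (f : V -> V') (g : W -> W') :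
    tensor V W -> tensor V' W' :=
  tlift (fun v w => f v ⊗ g w).

Definition tassoc (U V W : lmodType k) :
    tensor (tensor U V) W -> tensor U (tensor V W) :=
  tlift (fun s w => tlift (fun u v => u ⊗ (v ⊗ w)) s).

Definition tmul (H : algType k) (s t : tensor H H) : tensor H H :=
  tlift (fun a b => tlift (fun c d => (a * c) ⊗ (b * d)) t) s.

Definition tprod (A : algType k) : tensor A A -> A :=
  tlift (fun a b => a * b).

Definition submod (V : lmodType k) (S : set V) : Prop :=
  S 0 /\ forall c x y, S x -> S y -> S (c *: x + y).

Definition linspan (V : lmodType k) (X : set V) : set V := smallest (@submod V) X.

Record is_grading (V : lmodType k) (deg : nat -> set V) : Prop := IsGrading {
  grading_submod n : submod (deg n) ;
  grading_sum x : exists N (x_ : nat -> V),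
    (forall n, deg n (x_ n)) /\ x = \sum_(n < N) x_ n ;
  grading_direct N (x_ : nat -> V) : (forall n, deg n (x_ n)) ->
    \sum_(n < N) x_ n = 0 -> forall n, (n < N)%N -> x_ n = 0
}.

(* The part of positive degree, B = \bigoplus_(n >= 1) B_n.                   *)
Definition pospart (V : lmodType k) (deg : nat -> set V) : set V :=
  linspan (\bigcup_(n in [set n | (0 < n)%N]) deg n).

(* Degree n component of the tensor square of the graded space                *)
(* \bigoplus_(i >= m) deg i; used with m = 0 and m = 1.                       *)
Definition tdeg (V : lmodType k) (deg : nat -> set V) (m n : nat) :
    set (tensor V V) :=
  linspan [set t | exists i j a b,
    [/\ (m <= i)%N /\ (m <= j)%N, (i + j)%N = n, deg i a, deg j b & t = a ⊗ b]].

End TensorOps.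

(* The carrier is \overline B = k 1 + B. The maps B -> B ⊗ B are represented  *)
(* by their extensions by zero on 1, with values in the image of B ⊗ B in     *)
(* \overline B ⊗ \overline B.                                                 *)
Structure unshuffle_bialgebra (k : fieldType) := UnshuffleBialgebra {
  ub_alg :> algType k ;
  ub_deg : nat -> set ub_alg ;
  ub_counit : {linear ub_alg -> k^o} ;
  ub_cop : {linear ub_alg -> tensor ub_alg ub_alg} ;
  ub_rcop : {linear ub_alg -> tensor ub_alg ub_alg} ;
  ub_lcop : {linear ub_alg -> tensor ub_alg ub_alg} ;
  ub_scop : {linear ub_alg -> tensor ub_alg ub_alg} ;

  ub_grading : is_grading ub_deg ;
  ub_deg0 : ub_deg 0 = range (fun c : k => c *: (1 : ub_alg)) ;
  ub_degM : forall m n a b, ub_deg m a -> ub_deg n b -> ub_deg (m + n)%N (a * b) ;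

  ub_counit_deg : forall n, (0 < n)%N -> forall a, ub_deg n a -> ub_counit a = 0 ;
  ub_cop_deg : forall n a, ub_deg n a -> tdeg ub_deg 0 n (ub_cop a) ;
  ub_counitl : forall a, tlift (fun b c => (ub_counit b : k) *: c) (ub_cop a) = a ;
  ub_counitr : forall a, tlift (fun b c => (ub_counit c : k) *: b) (ub_cop a) = a ;
  ub_copA : forall a, tassoc (tmap ub_cop id (ub_cop a)) = tmap id ub_cop (ub_cop a) ;

  ub_counit1 : ub_counit 1 = 1 ;
  ub_counitM : forall a b, ub_counit (a * b) = ub_counit a * ub_counit b ;
  ub_cop1 : ub_cop 1 = 1 ⊗ 1 ;
  ub_copM : forall a b, ub_cop (a * b) = tmul (ub_cop a) (ub_cop b) ;

  ub_rcop1 : ub_rcop 1 = 0 ;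
  ub_copE : forall c, pospart ub_deg c -> ub_cop c = ub_rcop c + c ⊗ 1 + 1 ⊗ c ;
  ub_lcop1 : ub_lcop 1 = 0 ;
  ub_scop1 : ub_scop 1 = 0 ;
  ub_split_deg : forall n, (0 < n)%N -> forall a, ub_deg n a ->
        tdeg ub_deg 1 n (ub_lcop a) /\ tdeg ub_deg 1 n (ub_scop a) ;
  ub_rcopE : forall a, ub_rcop a = ub_lcop a + ub_scop a ;

  ub_lcop_lcop : forall a, tassoc (tmap ub_lcop id (ub_lcop a)) =
                   tmap id ub_rcop (ub_lcop a) ;
  ub_scop_lcop : forall a, tassoc (tmap ub_scop id (ub_lcop a)) =
                   tmap id ub_lcop (ub_scop a) ;
  ub_scop_scop : forall a, tassoc (tmap ub_rcop id (ub_scop a)) =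
                   tmap id ub_scop (ub_scop a) ;

  ub_lcopM : forall a b, pospart ub_deg a -> pospart ub_deg b ->
        ub_lcop (a * b) + (a * b) ⊗ 1 = tmul (ub_lcop a + a ⊗ 1) (ub_cop b) ;
  ub_scopM : forall a b, pospart ub_deg a -> pospart ub_deg b ->
        ub_scop (a * b) + 1 ⊗ (a * b) = tmul (ub_scop a + 1 ⊗ a) (ub_cop b)
}.

Arguments ub_deg {k u} _ _.
Arguments ub_counit {k u}.
Arguments ub_cop {k u}.
Arguments ub_rcop {k u}.
Arguments ub_lcop {k u}.
Arguments ub_scop {k u}.

Section Characters.
Context {k : fieldType} {H : unshuffle_bialgebra k} {A : comAlgType k}.
Implicit Types f g alpha mu nu : H -> A.

Definition augm : H -> A := fun x => (ub_counit x : k)%:A.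

Definition conv f g : H -> A := fun x => tprod (tmap f g (ub_cop x)).

(* f - f(1) e, the component of f in Lin(B, A) along f = f(1) e + (f - f(1) e) *)
Definition redfun f : H -> A := fun x => f x - f 1 * augm x.

(* The half-shuffles, bilinearly extended by f ≺ e = f = e ≻ f and            *)
(* e ≺ f = 0 = f ≻ e for f in Lin(B, A). The undefined products of e with     *)
(* itself are set to 0.                                                       *)
Definition hprec f g : H -> A := fun x =>
  tprod (tmap (redfun f) (redfun g) (ub_lcop x)) + g 1 * redfun f x.

Definition hsucc f g : H -> A := fun x =>
  tprod (tmap (redfun f) (redfun g) (ub_scop x)) + f 1 * redfun g x.

(* The inverse for conv in Lin(\overline B, A), if it exists.                 *)
Definition cinv f : H -> A :=
  xget 0 [set g : H -> A | linear g /\ conv f g = augm /\ conv g f = augm].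

Record inf_character (kappa : H -> A) : Prop := InfCharacter {
  inf_character_linear : linear kappa ;
  inf_character1 : kappa 1 = 0 ;
  inf_characterM a b : pospart (@ub_deg k H) a -> pospart (@ub_deg k H) b ->
    kappa (a * b) = 0
}.

(* Powers are indexed by n > 0. The sums over n > 0 are pointwise finite,     *)
(* since \overline B is graded and connected.                                 *)
Definition precpow alpha n : H -> A := iter n.-1 (hprec alpha) alpha.
Definition succpow alpha n : H -> A := iter n.-1 (hsucc^~ alpha) alpha.

Definition Eprec alpha : H -> A := fun x =>
  augm x + \sum_(n \in [set n | (0 < n)%N]) precpow alpha n x.

Definition Esucc alpha : H -> A := fun x =>
  augm x + \sum_(n \in [set n | (0 < n)%N]) succpow alpha n x.

Definition adprec mu nu : H -> A :=
  hprec (hsucc (cinv (Eprec mu)) nu) (Eprec mu).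

End Characters.

(* Main.v *)
Require Import Defs.
From mathcomp Require Import all_boot all_order all_algebra.
From mathcomp Require Import mathcomp_extra boolp classical_sets functions.
From mathcomp Require Import fsbigop.
From mathcomp Require Import ring.
Import GRing.Theory.
Local Open Scope classical_set_scope.
Local Open Scope ring_scope.

Set Implicit Arguments.
Unset Strict Implicit.

(** For linear f with f(1) = 0, the map g |-> f ≺ g strictly raises the degree
    below which g vanishes, so X = E_≺(f) is the unique linear solution of
    X = e + f ≺ X; symmetrically Y = E_≻(f) is that of Y = e + Y ≻ f. In
    particular E_≻(f) is the inverse of E_≺(- f), and each identity reduces to
    checking that its left-hand side solves the fixed-point equation of its
    right-hand side. With X = E_≺(γ1), β = X^-1 ≻ γ2 ≺ X and Z = E_≺(β), one has
    X * Z = X + X ≺ (β ≺ Z) + X ≻ (β ≺ Z)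
          = e + (γ1 ≺ X) ≺ Z + (X ≻ β) ≺ Z,
    where X ≻ β = (X * X^-1) ≻ γ2 ≺ X = γ2 ≺ X, so that
    X * Z = e + (γ1 + γ2) ≺ (X * Z). *)

(** * Linearity as a predicate on plain functions *)

Section LinearMaps.
Context {k : fieldType} {V W : lmodType k}.

Lemma linear0P (f : V -> W) : linear f -> f 0 = 0.
Proof.
by move=> lf; rewrite -[in LHS](subrr 0) (zmod_morphism_linear lf) subrr.
Qed.

Lemma linearDP (f : V -> W) : linear f -> {morph f : x y / x + y}.
Proof. by move=> lf x y; rewrite -[x in LHS]scale1r lf scale1r. Qed.

Lemma linearZP (f : V -> W) : linear f -> scalable f.
Proof. exact: scalable_linear. Qed.

Lemma linear_sumP (f : V -> W) (I : Type) (r : seq I) (P : pred I) (F : I -> V) :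
  linear f -> f (\sum_(i <- r | P i) F i) = \sum_(i <- r | P i) f (F i).
Proof.
by move=> lf; apply: (big_morph f (linearDP lf) (linear0P lf)).
Qed.

Lemma linear_add (f g : V -> W) : linear f -> linear g -> linear (f + g).
Proof.
by move=> lf lg c x y; rewrite !fctE lf lg scalerDr addrACA.
Qed.

Lemma linear_opp (f : V -> W) : linear f -> linear (- f).
Proof. by move=> lf c x y; rewrite !fctE lf opprD scalerN. Qed.

Lemma linear_sub (f g : V -> W) : linear f -> linear g -> linear (f - g).
Proof. by move=> lf lg; apply/linear_add/linear_opp. Qed.

Lemma linear_scale (c : k) (f : V -> W) : linear f -> linear (c \*: f).
Proof. by move=> lf d x y; rewrite /= lf scalerDr !scalerA mulrC. Qed.

Lemma linear_zero : linear (0 : V -> W).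
Proof. by move=> c x y; rewrite -[LHS]/0 scaler0 addr0. Qed.

End LinearMaps.

Lemma linear_comp (k : fieldType) (U V W : lmodType k) (g : V -> W) (f : U -> V) :
  linear g -> linear f -> linear (fun x => g (f x)).
Proof. by move=> lg lf c x y; rewrite lf lg. Qed.

Lemma linear_mull (k : fieldType) (V : lmodType k) (A : comAlgType k) (a : A)
    (f : V -> A) :
  linear f -> linear (fun x => a * f x).
Proof. by move=> lf c x y; rewrite lf mulrDr scalerAr. Qed.

Lemma linear_pack (k : fieldType) (U V : lmodType k) (f : {linear U -> V}) : linear f.
Proof. exact: linearP. Qed.

Lemma linear_id (k : fieldType) (U : lmodType k) : linear (fun x : U => x).
Proof. by []. Qed.

#[local] Hint Resolve linear_pack linear_id : core.

Ltac lin := repeat first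
  [ done | apply: linear_add | apply: linear_sub | apply: linear_opp
  | apply: linear_zero | apply: linear_scale | apply: linear_mull ].

(** * Maps out of tensor products, and the pairing of two linear maps into an algebra *)

Section Tensors.
Context {k : fieldType}.

Lemma tens_linearl (V W : lmodType k) (w : W) : linear (fun v : V => v ⊗ w).
Proof. exact: (tens_bilinear.1). Qed.

Lemma tens_linearr (V W : lmodType k) (v : V) : linear (fun w : W => v ⊗ w).
Proof. exact: (tens_bilinear.2). Qed.

(** By the universal property, each map is the lift of its values on pure tensors. *)
Lemma tens_ext (V W U : lmodType k) (f g : tensor V W -> U) :
  linear f -> linear g -> (forall v w, f (v ⊗ w) = g (v ⊗ w)) -> f =1 g.
Proof.
move=> lf lg fg t.
rewrite (tlift_unique lf (fun v w => erefl)) (tlift_unique lg (fun v w => erefl)).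
by congr tlift; apply/funext => v; apply/funext => w.
Qed.

Lemma tmap_bilinear (V W V' W' : lmodType k) (f : V -> V') (g : W -> W') :
  linear f -> linear g -> is_bilinear (fun v w => f v ⊗ g w).
Proof.
move=> lf lg; split=> [w|v].
  exact: linear_comp (@tens_linearl _ _ (g w)) lf.
exact: linear_comp (@tens_linearr _ _ (f v)) lg.
Qed.

Lemma tmap_linear (V W V' W' : lmodType k) (f : V -> V') (g : W -> W') :
  linear f -> linear g -> linear (tmap f g).
Proof. by move=> lf lg; apply/tlift_linear/tmap_bilinear. Qed.

Lemma tmapE (V W V' W' : lmodType k) (f : V -> V') (g : W -> W') v w :
  linear f -> linear g -> tmap f g (v ⊗ w) = f v ⊗ g w.
Proof. by move=> lf lg; rewrite /tmap tliftE//; apply: tmap_bilinear. Qed.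

Lemma tassoc_inner_bilinear (U V W : lmodType k) (w : W) :
  is_bilinear (fun (u : U) (v : V) => u ⊗ (v ⊗ w)).
Proof.
split=> [v|u]; first exact: tens_linearl.
exact: linear_comp (@tens_linearr _ _ u) (@tens_linearl _ _ w).
Qed.

Lemma tassoc_bilinear (U V W : lmodType k) :
  is_bilinear (fun (s : tensor U V) (w : W) => tlift (fun u v => u ⊗ (v ⊗ w)) s).
Proof.
have lin (w : W) :
    linear (tlift (fun (u : U) (v : V) => u ⊗ (v ⊗ w))).
  exact/tlift_linear/tassoc_inner_bilinear.
split=> [w|s c w w']; first exact: lin.
(* Linearity in [w] concerns the map being lifted, so both sides are compared as linear functions of
   [s], on pure tensors. *)
apply: (@tens_ext _ _ _ _ (c \*: tlift (fun u v => u ⊗ (v ⊗ w))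
  + tlift (fun u v => u ⊗ (v ⊗ w')))); try by lin; exact: lin.
move=> u v; rewrite !fctE /=; rewrite !tliftE; try exact: tassoc_inner_bilinear.
by rewrite tens_linearr tens_linearr.
Qed.

Lemma tassoc_linear (U V W : lmodType k) : linear (@tassoc k U V W).
Proof. exact/tlift_linear/tassoc_bilinear. Qed.

Lemma tassocE (U V W : lmodType k) (u : U) (v : V) (w : W) :
  tassoc ((u ⊗ v) ⊗ w) = u ⊗ (v ⊗ w).
Proof.
by rewrite /tassoc !tliftE//; [exact: tassoc_inner_bilinear|exact: tassoc_bilinear].
Qed.

Context {A : comAlgType k}.

Lemma mul_bilinear : is_bilinear (fun a b : A => a * b).
Proof.
split=> [b|a] c x y /=; first by rewrite mulrDl scalerAl.
by rewrite mulrDr scalerAr.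
Qed.

(** This is m_A (f ⊗ g), the common part of [conv], [hprec] and [hsucc]. *)
Definition tpair (V W : lmodType k) (f : V -> A) (g : W -> A)
    (t : tensor V W) : A :=
  tprod (tmap f g t).

Lemma tpair_linear (V W : lmodType k) (f : V -> A) (g : W -> A) :
  linear f -> linear g -> linear (tpair f g).
Proof.
move=> lf lg; apply: linear_comp; last exact: tmap_linear.
exact: tlift_linear mul_bilinear.
Qed.

Lemma tpairE (V W : lmodType k) (f : V -> A) (g : W -> A) v w :
  linear f -> linear g -> tpair f g (v ⊗ w) = f v * g w.
Proof.
by move=> lf lg; rewrite /tpair tmapE// /tprod tliftE//; exact: mul_bilinear.
Qed.

Ltac tlin := repeat first
  [ progress lin | apply: tpair_linear | apply: tassoc_linear | apply: tmap_linear ].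

Lemma tpairDl (V W : lmodType k) (f f' : V -> A) (g : W -> A) t :
  linear f -> linear f' -> linear g ->
  tpair (f + f') g t = tpair f g t + tpair f' g t.
Proof.
move=> lf lf' lg.
apply: (@tens_ext _ _ _ _ (tpair f g + tpair f' g)); tlin.
by move=> v w; rewrite !fctE !tpairE; tlin; rewrite -mulrDl.
Qed.

Lemma tpairDr (V W : lmodType k) (f : V -> A) (g g' : W -> A) t :
  linear f -> linear g -> linear g' ->
  tpair f (g + g') t = tpair f g t + tpair f g' t.
Proof.
move=> lf lg lg'.
apply: (@tens_ext _ _ _ _ (tpair f g + tpair f g')); tlin.
by move=> v w; rewrite !fctE !tpairE; tlin; rewrite -mulrDr.
Qed.

Lemma tpairZl (V W : lmodType k) a (f : V -> A) (g : W -> A) t :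
  linear f -> linear g ->
  tpair (fun x => a * f x) g t = a * tpair f g t.
Proof.
move=> lf lg.
apply: (@tens_ext _ _ _ _ (fun t => a * tpair f g t)); tlin.
by move=> v w; rewrite !tpairE; tlin; rewrite -mulrA.
Qed.

Lemma tpairZr (V W : lmodType k) a (f : V -> A) (g : W -> A) t :
  linear f -> linear g ->
  tpair f (fun x => a * g x) t = a * tpair f g t.
Proof.
move=> lf lg.
apply: (@tens_ext _ _ _ _ (fun t => a * tpair f g t)); tlin.
by move=> v w; rewrite !tpairE; tlin; rewrite mulrCA.
Qed.

Lemma tpair_tmapl (V V' W : lmodType k) (D : V -> V') (f : V' -> A) (g : W -> A) t :
  linear D -> linear f -> linear g ->
  tpair f g (tmap D id t) = tpair (fun x => f (D x)) g t.
Proof.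
move=> lD lf lg; have lfD := linear_comp lf lD.
apply: (@tens_ext _ _ _ (fun t => tpair f g (tmap D id t))); tlin.
  by apply: linear_comp; tlin; exact: tmap_linear.
by move=> v w; rewrite tmapE// !tpairE.
Qed.

Lemma tpair_tmapr (V W W' : lmodType k) (D : W -> W') (f : V -> A) (g : W' -> A) t :
  linear D -> linear f -> linear g ->
  tpair f g (tmap id D t) = tpair f (fun x => g (D x)) t.
Proof.
move=> lD lf lg; have lgD := linear_comp lg lD.
apply: (@tens_ext _ _ _ (fun t => tpair f g (tmap id D t))); tlin.
  by apply: linear_comp; tlin; exact: tmap_linear.
by move=> v w; rewrite tmapE// !tpairE.
Qed.

(** Associativity of A, read on pure tensors: one extensionality argument for the outer tensor
    product, a second one for the slice s ↦ s ⊗ w. *)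
Lemma tpair_tassoc (U V W : lmodType k) (f : U -> A) (g : V -> A) (h : W -> A) t :
  linear f -> linear g -> linear h ->
  tpair f (tpair g h) (tassoc t) = tpair (tpair f g) h t.
Proof.
move=> lf lg lh; move: t.
have lfg := tpair_linear lf lg; have lgh := tpair_linear lg lh.
have l1 : linear (fun t => tpair f (tpair g h) (@tassoc k U V W t)).
  by apply: linear_comp; tlin; exact: tmap_linear.
apply: tens_ext ; tlin; move=> s w.
have ltw := @tens_linearl _ _ w.
apply: (@tens_ext _ _ _ (fun s => tpair f (tpair g h) (tassoc (s ⊗ w)))
   (fun s => tpair (tpair f g) h (s ⊗ w))).
- exact: linear_comp l1 (ltw _).
- exact: linear_comp (tpair_linear _ _) (ltw _); tlin.
- by move=> u v; rewrite tassocE !tpairE; tlin; rewrite mulrA.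
Qed.

(** The equalizer of two linear maps is a submodule, so it contains the span as soon as it contains
    X. *)
Lemma linspan_ext (V U : lmodType k) (X : set V) (f g : V -> U) :
  linear f -> linear g -> {in X, f =1 g} -> {in linspan X, f =1 g}.
Proof.
move=> lf lg fg x; rewrite inE => /(_ [set y | f y = g y]); apply; split.
  split=> [|c y z /= fy fz]; first by rewrite /= !linear0P.
  by rewrite lf lg fy fz.
by move=> y Xy; apply: fg; rewrite inE.
Qed.

End Tensors.

(** * Extensionality along the grading *)

Section Bialgebra.
Context {k : fieldType} {H : unshuffle_bialgebra k} {A : comAlgType k}.
Implicit Types f g h : H -> A.
Local Notation deg := (@ub_deg k H).
Local Notation augm := (@augm k H A).

Lemma deg_ext (U : lmodType k) (f g : H -> U) : linear f -> linear g ->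
  (forall n x, deg n x -> f x = g x) -> f = g.
Proof.
move=> lf lg fg; apply/funext => x.
have [N [x_ [dx ->]]] := grading_sum (ub_grading H) x.
by rewrite !linear_sumP//; apply: eq_bigr => i _; exact: fg (dx i).
Qed.

Lemma deg0P x : deg 0 x -> exists c : k, x = c *: 1.
Proof. by rewrite ub_deg0 => -[c _ <-]; exists c. Qed.

Lemma deg01 : deg 0 1.
Proof. by rewrite ub_deg0; exists 1; rewrite ?scale1r. Qed.

(** Connectedness: degree 0 consists of the multiples of 1. *)
Lemma unit_deg_ext (U : lmodType k) (f g : H -> U) : linear f -> linear g ->
  f 1 = g 1 -> (forall n x, (0 < n)%N -> deg n x -> f x = g x) -> f = g.
Proof.
move=> lf lg fg1 fg; apply: deg_ext => // -[|n] x; last exact: fg.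
by move=> /deg0P[c ->]; rewrite !linearZP// fg1.
Qed.

Lemma deg_pospart n x : (0 < n)%N -> deg n x -> pospart deg x.
Proof. by move=> n0 dx S [_]; apply; exists n. Qed.

Lemma tdeg_ext (U : lmodType k) (f g : tensor H H -> U) m n t :
  linear f -> linear g -> tdeg deg m n t ->
  (forall i j a b, (m <= i)%N -> (m <= j)%N -> (i + j)%N = n ->
     deg i a -> deg j b -> f (a ⊗ b) = g (a ⊗ b)) -> f t = g t.
Proof.
move=> lf lg dt fg; apply: (linspan_ext lf lg _ (mem_set dt)) => s.
by rewrite inE => -[i [j [a [b [[mi mj] ij da db ->]]]]]; exact: (fg i j).
Qed.

(** * The augmentation and the reduced maps *)

Lemma augm_linear : linear augm.
Proof. by move=> c x y; rewrite /augm (linear_pack ub_counit) scalerDl scalerA. Qed.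

Lemma augm1 : augm 1 = 1.
Proof. by rewrite /augm ub_counit1 scale1r. Qed.

Lemma augm_deg n x : (0 < n)%N -> deg n x -> augm x = 0.
Proof. by move=> n0 dx; rewrite /augm (ub_counit_deg n0 dx) scale0r. Qed.

Lemma redfun_linear f : linear f -> linear (redfun f).
Proof.
move=> lf c x y; rewrite /redfun lf augm_linear mulrDr -scalerAr opprD.
by rewrite scalerBr addrACA.
Qed.

Lemma redfun1 f : redfun f 1 = 0.
Proof. by rewrite /redfun augm1 mulr1 subrr. Qed.

Lemma redfun_id f : f 1 = 0 -> redfun f = f.
Proof. by move=> f1; apply/funext => x; rewrite /redfun f1 mul0r subr0. Qed.

Lemma redfun_augm : redfun augm = 0.
Proof. by apply/funext => x; rewrite /redfun augm1 mul1r subrr. Qed.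

Lemma redfunD f g : redfun (f + g) = redfun f + redfun g.
Proof.
by apply/funext => x; rewrite /redfun !fctE mulrDl opprD addrACA.
Qed.

Lemma redfun_deg f n x : (0 < n)%N -> deg n x -> redfun f x = f x.
Proof. by move=> n0 dx; rewrite /redfun (augm_deg n0 dx) mulr0 subr0. Qed.

(** Leaving the coproduct D free allows bilinearity and associativity to be proved once for the full
    coproduct and for both half-coproducts. *)
Definition convby (D : H -> tensor H H) f g : H -> A := fun x => tpair f g (D x).

Lemma convby_linear D f g : linear D -> linear f -> linear g ->
  linear (convby D f g).
Proof. by move=> lD lf lg; apply: linear_comp => //; exact: tpair_linear. Qed.

Ltac clin := repeat first
  [ done | apply: linear_add | apply: linear_mull
  | apply: convby_linear => //; exact: linear_pack
  | apply: convby_linear => //; first exact: linear_pack ].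

Lemma convbyDl D f f' g : linear f -> linear f' -> linear g ->
  convby D (f + f') g = convby D f g + convby D f' g.
Proof. by move=> *; apply/funext => x; exact: tpairDl. Qed.

Lemma convbyDr D f g g' : linear f -> linear g -> linear g' ->
  convby D f (g + g') = convby D f g + convby D f g'.
Proof. by move=> *; apply/funext => x; exact: tpairDr. Qed.

Lemma convbyZl D a f g : linear f -> linear g ->
  convby D (fun x => a * f x) g = (fun x => a * convby D f g x).
Proof. by move=> *; apply/funext => x; exact: tpairZl. Qed.

Lemma convbyZr D a f g : linear f -> linear g ->
  convby D f (fun x => a * g x) = (fun x => a * convby D f g x).
Proof. by move=> *; apply/funext => x; exact: tpairZr. Qed.

Lemma convby0l D g : linear g -> convby D 0 g = 0.
Proof.
by move=> lg; have := convbyDl D (@linear_zero _ _ _) (@linear_zero _ _ _) lg;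
  rewrite addr0 -[LHS]addr0 => /addrI.
Qed.

Lemma convby_tensor (D : H -> tensor H H) f g x a b :
  linear f -> linear g -> D x = a ⊗ b -> convby D f g x = f a * g b.
Proof. by move=> lf lg Dx; rewrite /convby Dx tpairE. Qed.

Lemma convby1 (D : H -> tensor H H) f g :
  linear f -> linear g -> D 1 = 0 -> convby D f g 1 = 0.
Proof. by move=> lf lg D1; rewrite /convby D1 linear0P//; exact/tpair_linear. Qed.

(** Four independent coproducts, because coassociativity and the three unshuffle axioms all have
    this shape and differ only in where each coproduct stands. *)
Lemma convbyA (D1 D2 D3 D4 : {linear H -> tensor H H}) f g h :
  (forall x, tassoc (tmap D1 id (D2 x)) = tmap id D3 (D4 x)) ->
  linear f -> linear g -> linear h ->
  convby D2 (convby D1 f g) h = convby D4 f (convby D3 g h).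
Proof.
move=> DA lf lg lh; apply/funext => x; rewrite /convby.
have lgh := tpair_linear lg lh; have lfg := tpair_linear lf lg.
rewrite -(tpair_tmapl (D2 x) (linear_pack D1) lfg lh) -tpair_tassoc// DA.
exact: tpair_tmapr (linear_pack D3) lf lgh.
Qed.

(** * The half-shuffles and their sum, the convolution *)

Lemma hprecE f g :
  hprec f g = convby ub_lcop (redfun f) (redfun g) + (fun x => g 1 * redfun f x).
Proof. by []. Qed.

Lemma hsuccE f g :
  hsucc f g = convby ub_scop (redfun f) (redfun g) + (fun x => f 1 * redfun g x).
Proof. by []. Qed.

Lemma convE f g : conv f g = convby ub_cop f g.
Proof. by []. Qed.

Lemma hprec_linear f g : linear f -> linear g -> linear (hprec f g).
Proof.
move=> lf lg; apply: linear_add; last exact/linear_mull/redfun_linear.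
by apply: convby_linear; first exact: linear_pack; exact: redfun_linear.
Qed.

Lemma hsucc_linear f g : linear f -> linear g -> linear (hsucc f g).
Proof.
move=> lf lg; apply: linear_add; last exact/linear_mull/redfun_linear.
by apply: convby_linear; first exact: linear_pack; exact: redfun_linear.
Qed.

Lemma conv_linear f g : linear f -> linear g -> linear (conv f g).
Proof. by apply: convby_linear; exact: linear_pack. Qed.

Lemma hprec1 f g : linear f -> linear g -> hprec f g 1 = 0.
Proof.
move=> lf lg; rewrite hprecE fctE redfun1 mulr0 addr0.
by apply: convby1 (ub_lcop1 _); exact: redfun_linear.
Qed.

Lemma hsucc1 f g : linear f -> linear g -> hsucc f g 1 = 0.
Proof.
move=> lf lg; rewrite hsuccE fctE redfun1 mulr0 addr0.
by apply: convby1 (ub_scop1 _); exact: redfun_linear.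
Qed.

Lemma conv1 f g : linear f -> linear g -> conv f g 1 = f 1 * g 1.
Proof. by move=> lf lg; rewrite convE; apply/convby_tensor/ub_cop1. Qed.

(** In positive degree the summands c ⊗ 1 and 1 ⊗ c of the coproduct yield the extension terms of
    the two half-shuffles. The last term is needed at 1, where both half-shuffles vanish because the
    products of e with itself are set to 0. *)
Lemma conv_hprec_hsucc f g : linear f -> linear g ->
  conv f g = hprec f g + hsucc f g + (fun x => f 1 * g 1 * augm x).
Proof.
move=> lf lg; have lrf := redfun_linear lf; have lrg := redfun_linear lg.
have lP := hprec_linear lf lg; have lS := hsucc_linear lf lg.
apply: unit_deg_ext.
- exact: conv_linear.
- by lin; exact: augm_linear.
- by rewrite !fctE conv1// hprec1// hsucc1// augm1 !add0r mulr1.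
move=> n x n0 dx; rewrite !fctE (augm_deg n0 dx) mulr0 addr0.
rewrite convE /convby ub_copE; last exact: deg_pospart dx.
rewrite !(linearDP (tpair_linear lf lg)) !tpairE//.
(* The half-coproducts take values in B ⊗ B, where a map and its reduced map agree. *)
have tpair_red t : tdeg deg 1 n t -> tpair f g t = tpair (redfun f) (redfun g) t.
  move=> dt; apply: tdeg_ext dt _; [exact: tpair_linear..|].
  move=> i j a b i0 j0 _ da db.
  by rewrite !tpairE// (redfun_deg _ i0 da) (redfun_deg _ j0 db).
have [dl ds] := ub_split_deg n0 dx.
rewrite ub_rcopE (linearDP (tpair_linear lf lg)) !tpair_red//.
rewrite hprecE hsuccE !fctE !(redfun_deg _ n0 dx) (mulrC (g 1)) -!addrA.
by congr +%R; rewrite addrCA.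
Qed.

Lemma redfun_conv f g : linear f -> linear g ->
  redfun (conv f g) = hprec f g + hsucc f g.
Proof.
move=> lf lg; apply/funext => x; rewrite /redfun conv1// conv_hprec_hsucc//.
by rewrite !fctE addrK.
Qed.

Lemma hprecDl f f' g : linear f -> linear f' -> linear g ->
  hprec (f + f') g = hprec f g + hprec f' g.
Proof.
move=> lf lf' lg; rewrite !hprecE redfunD convbyDl; [|exact: redfun_linear..].
by apply/funext => x; rewrite !fctE mulrDr addrACA.
Qed.

Lemma hprecDr f g g' : linear f -> linear g -> linear g' ->
  hprec f (g + g') = hprec f g + hprec f g'.
Proof.
move=> lf lg lg'; rewrite !hprecE redfunD convbyDr; [|exact: redfun_linear..].
by apply/funext => x; rewrite !fctE mulrDl addrACA.
Qed.

Lemma hsuccDl f f' g : linear f -> linear f' -> linear g ->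
  hsucc (f + f') g = hsucc f g + hsucc f' g.
Proof.
move=> lf lf' lg; rewrite !hsuccE redfunD convbyDl; [|exact: redfun_linear..].
by apply/funext => x; rewrite !fctE mulrDl addrACA.
Qed.

Lemma hsuccDr f g g' : linear f -> linear g -> linear g' ->
  hsucc f (g + g') = hsucc f g + hsucc f g'.
Proof.
move=> lf lg lg'; rewrite !hsuccE redfunD convbyDr; [|exact: redfun_linear..].
by apply/funext => x; rewrite !fctE mulrDr addrACA.
Qed.

Lemma convDl f f' g : linear f -> linear f' -> linear g ->
  conv (f + f') g = conv f g + conv f' g.
Proof. exact: convbyDl. Qed.

Lemma convDr f g g' : linear f -> linear g -> linear g' ->
  conv f (g + g') = conv f g + conv f g'.
Proof. exact: convbyDr. Qed.

Lemma convA f g h : linear f -> linear g -> linear h ->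
  conv f (conv g h) = conv (conv f g) h.
Proof.
by move=> lf lg lh; rewrite !convE; apply/esym/convbyA => //; exact: ub_copA.
Qed.

(** * The augmentation as a unit *)

Lemma hprec_augml g : linear g -> hprec augm g = 0.
Proof.
move=> lg; rewrite hprecE redfun_augm convby0l; last exact: redfun_linear.
by apply/funext => x; rewrite !fctE mulr0 addr0.
Qed.

Lemma convby0r D f : linear f -> convby D f 0 = 0.
Proof.
by move=> lf; have := convbyDr D lf (@linear_zero _ _ _) (@linear_zero _ _ _);
  rewrite addr0 -[LHS]addr0 => /addrI.
Qed.

Lemma hprec_augmr f : linear f -> f 1 = 0 -> hprec f augm = f.
Proof.
move=> lf f1; rewrite hprecE redfun_augm redfun_id// convby0r// augm1 add0r.
by apply/funext => x; rewrite mul1r.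
Qed.

Lemma hsucc_augmr f : linear f -> hsucc f augm = 0.
Proof.
move=> lf; rewrite hsuccE redfun_augm convby0r; last exact: redfun_linear.
by apply/funext => x; rewrite !fctE mulr0 addr0.
Qed.

Lemma hsucc_augml f : linear f -> f 1 = 0 -> hsucc augm f = f.
Proof.
move=> lf f1; rewrite hsuccE redfun_augm redfun_id// convby0l// augm1 add0r.
by apply/funext => x; rewrite mul1r.
Qed.

Lemma conv_augml f : linear f -> conv augm f = f.
Proof.
move=> lf; rewrite conv_hprec_hsucc//; last exact: augm_linear.
rewrite hprec_augml// hsuccE redfun_augm convby0l; last exact: redfun_linear.
by apply/funext => x; rewrite !fctE augm1 /redfun !mul1r !add0r subrK.
Qed.

Lemma conv_augmr f : linear f -> conv f augm = f.
Proof.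
move=> lf; rewrite conv_hprec_hsucc//; last exact: augm_linear.
rewrite hsucc_augmr// hprecE redfun_augm convby0r; last exact: redfun_linear.
by apply/funext => x; rewrite !fctE augm1 /redfun mulr1 mul1r add0r addr0 subrK.
Qed.

Lemma convby_rcop f g : linear f -> linear g ->
  convby ub_rcop f g = convby ub_lcop f g + convby ub_scop f g.
Proof.
move=> lf lg; apply/funext => x; rewrite /convby ub_rcopE.
exact: linearDP (tpair_linear lf lg) _ _.
Qed.

(** * The half-shuffle identities, one for each unshuffle axiom *)

Lemma hprecA f g h : linear f -> linear g -> linear h -> f 1 = 0 ->
  hprec (hprec f g) h = hprec f (conv g h).
Proof.
move=> lf lg lh f1; rewrite [LHS]hprecE [RHS]hprecE redfun_conv// conv1//.
rewrite (redfun_id (hprec1 lf lg)) !hprecE hsuccE (redfun_id f1).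
have := redfun_linear lg; have := redfun_linear lh.
(* From here on [g] and [h] denote the reduced maps and [a], [b] the values at 1; the axiom handles
   the reduced parts, and [ring] matches the terms carrying [a] and [b]. *)
move: (redfun g) (redfun h) (g 1) (h 1) => {lg lh}g {}h a b lh lg.
rewrite convbyDl; [|clin..]; rewrite convbyZl; [|clin..].
rewrite (convbyA (@ub_lcop_lcop k H))// convby_rcop//.
do 4?[rewrite convbyDr; [|clin..]]; rewrite !convbyZr; [|clin..].
by apply/funext => x; rewrite !fctE; ring.
Qed.

Lemma hprec_hsuccA f g h : linear f -> linear g -> linear h -> g 1 = 0 ->
  hprec (hsucc f g) h = hsucc f (hprec g h).
Proof.
move=> lf lg lh g1; rewrite [LHS]hprecE [RHS]hsuccE.
rewrite (redfun_id (hsucc1 lf lg)) (redfun_id (hprec1 lg lh)).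
rewrite hprecE hsuccE (redfun_id g1).
have := redfun_linear lf; have := redfun_linear lh.
move: (redfun f) (redfun h) (f 1) (h 1) => {lf lh}f {}h a b lh lf.
rewrite convbyDl; [|clin..]; rewrite convbyZl; [|clin..].
rewrite (convbyA (@ub_scop_lcop k H))//.
rewrite convbyDr; [|clin..]; rewrite convbyZr; [|clin..].
by apply/funext => x; rewrite !fctE; ring.
Qed.

Lemma hsuccA f g h : linear f -> linear g -> linear h -> h 1 = 0 ->
  hsucc f (hsucc g h) = hsucc (conv f g) h.
Proof.
move=> lf lg lh h1; rewrite [LHS]hsuccE [RHS]hsuccE redfun_conv// conv1//.
rewrite (redfun_id (hsucc1 lg lh)) !hsuccE hprecE (redfun_id h1).
have := redfun_linear lf; have := redfun_linear lg.
move: (redfun f) (redfun g) (f 1) (g 1) => {lf lg}f {}g a b lg lf.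
rewrite convbyDr; [|clin..]; rewrite convbyZr; [|clin..].
rewrite -(convbyA (@ub_scop_scop k H))// convby_rcop//.
do 4?[rewrite convbyDl; [|clin..]]; rewrite !convbyZl; [|clin..].
by apply/funext => x; rewrite !fctE; ring.
Qed.

(** * The filtration by order of vanishing, and fixed points of maps that raise it *)

Definition vanish n f := forall m x, (m < n)%N -> deg m x -> f x = 0.

(* Makes f |-> h + Phi f a contraction for the topology defined by vanish. *)
Record raising (Phi : (H -> A) -> (H -> A)) : Prop := Raising {
  raising_linear f : linear f -> linear (Phi f) ;
  raisingB f g : linear f -> linear g -> Phi (f - g) = Phi f - Phi g ;
  raising_vanish n f : linear f -> vanish n f -> vanish n.+1 (Phi f)
}.

(** An element has finitely many homogeneous components, so N depends on x alone. This makes the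
    filtration separated and the series below pointwise finite. *)
Lemma vanish_eventually x :
  exists N, forall n f, (N <= n)%N -> linear f -> vanish n f -> f x = 0.
Proof.
have [N [x_ [dx ->]]] := grading_sum (ub_grading H) x.
exists N => n f Nn lf fn; rewrite linear_sumP// big1// => i _.
by apply: fn (dx i); exact: leq_trans (ltn_ord i) Nn.
Qed.

Lemma vanish_eq0 f : linear f -> (forall n, vanish n f) -> f = 0.
Proof.
move=> lf fn; apply/funext => x; have [N /(_ N f)] := vanish_eventually x.
exact.
Qed.

(** The difference of two solutions is fixed by [Phi], hence vanishes to every order. *)
Lemma raising_unique Phi f g h : raising Phi -> linear f -> linear g ->
  f = h + Phi f -> g = h + Phi g -> f = g.
Proof.
move=> [Pl PB Pv] lf lg fE gE; apply: subr0_eq; apply: vanish_eq0; first by lin.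
elim=> [m x //|n IHn].
rewrite fE gE opprD addrACA subrr add0r -PB//.
by apply: Pv IHn; lin.
Qed.

(* The pointwise finite sum of the Phi^n e, n >= 0. *)
Definition geom (Phi : (H -> A) -> (H -> A)) : H -> A := fun x =>
  augm x + \sum_(n \in [set n | (0 < n)%N]) iter n Phi augm x.

Section Geom.
Context (Phi : (H -> A) -> (H -> A)) (Phi_raising : raising Phi).

Let term n := iter n Phi augm.
Let psum N := \sum_(n < N) term n.

Let term_linear n : linear (term n).
Proof.
elim: n => [|n IHn]; first exact: augm_linear.
exact: (raising_linear Phi_raising).
Qed.

Let term_vanish n : vanish n (term n).
Proof.
elim: n => [m x //|n IHn]; exact: (raising_vanish Phi_raising (term_linear n)).
Qed.

Let psumS N : psum N.+1 = psum N + term N.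
Proof. exact: big_ord_recr. Qed.

Let psum_linear N : linear (psum N).
Proof.
elim: N => [|N IHN]; first by rewrite /psum big_ord0; lin.
by rewrite psumS; lin.
Qed.

Let psum_fix N : psum N.+1 = augm + Phi (psum N).
Proof.
elim: N => [|N IHN].
  (* [raising] gives compatibility with subtraction, so [Phi 0 = 0] is obtained by writing 0 as 0 -
     0. *)
  rewrite psumS /psum big_ord0 add0r -(subrr (0 : H -> A)).
  by rewrite (raisingB Phi_raising)//= ?subrr ?addr0//; lin.
have termE : psum N.+1 - psum N = term N by rewrite psumS addrC addKr.
rewrite psumS -[term N.+1]/(Phi (term N)) -termE.
rewrite (raisingB Phi_raising)// {1}IHN -!addrA; congr +%R.
by rewrite addrCA subrr addr0.
Qed.

Let geomE x N : (forall n, (N <= n)%N -> term n x = 0) -> (0 < N)%N ->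
  geom Phi x = psum N x.
Proof.
case: N => // N tx _; rewrite /psum /geom fct_sumE big_ord_recl /=; congr +%R.
(* The list 1, ..., N enumerates the indices of the ordinal sum below [N.+1] other than 0, whose
   term [augm] has been split off. *)
rewrite (fsbigE (iota 1 N)) ?iota_uniq//=.
- rewrite -[in RHS](big_mkord xpredT (fun i => iter i.+1 Phi augm x)).
  rewrite -[iota 1 N]/(iota (1 + 0) N) iotaDl big_map -[X in iota 0 X]subn0.
  by apply: eq_bigl => i; rewrite mem_set.
- by move=> i /=; rewrite mem_iota => /andP[].
- move=> i /= i0; rewrite mem_iota i0 add1n -leqNgt; exact: tx.
Qed.

Let geom_psum x : exists N, forall n, (N <= n)%N -> geom Phi x = psum n x.
Proof.
have [N Nx] := vanish_eventually x.
exists N.+1 => n Nn; apply: geomE; last exact: leq_trans Nn.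
by move=> m nm; apply: (Nx m) => //; exact: leq_trans (ltnW Nn) nm.
Qed.

Lemma geom_linear : linear (geom Phi).
Proof.
move=> c x y.
have [Nx xE] := geom_psum x; have [Ny yE] := geom_psum y.
have [N NE] := geom_psum (c *: x + y).
(* One partial sum that computes [geom Phi] at all three points. *)
pose M := maxn N (maxn Nx Ny).
rewrite (xE M) ?(yE M) ?(NE M) ?psum_linear// /M !leq_max ?leqnn ?orbT//.
Qed.

Let geom_vanish N : vanish N (geom Phi - psum N).
Proof.
move=> m x mN dx; apply/eqP; rewrite subr_eq0; apply/eqP; apply: geomE => //.
  by move=> n Nn; apply: term_vanish dx; exact: leq_trans mN Nn.
exact: leq_ltn_trans mN.
Qed.

(** The defect of the equation is the tail after [N.+1] terms minus [Phi] of the tail after N terms.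
    Both vanish below degree [N.+1], for every N. *)
Lemma geom_fix : geom Phi = augm + Phi (geom Phi).
Proof.
have lg := geom_linear; have lP := raising_linear Phi_raising lg.
have la := augm_linear.
apply: subr0_eq; apply: vanish_eq0; first by lin.
case=> [m x //|N].
have -> : geom Phi - (augm + Phi (geom Phi)) =
    (geom Phi - psum N.+1) - (Phi (geom Phi - psum N)).
  by rewrite (raisingB Phi_raising)// psum_fix opprB !opprD -[RHS]addrA; congr +%R;
    rewrite [RHS]addrA subrK.
move=> m x mN dx.
rewrite -[LHS]/((geom Phi - psum N.+1) x - Phi (geom Phi - psum N) x).
rewrite (geom_vanish mN dx) sub0r.
rewrite (raising_vanish Phi_raising _ _ mN dx) ?oppr0//; by lin.
Qed.

End Geom.

(** * Multiplication operators that raise the filtration, and convolution inverses *)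

Lemma convby_vanish (D : {linear H -> tensor H H}) f g d m n x :
  (forall y, deg m y -> tdeg deg d m (D y)) -> linear f -> linear g ->
  (m < n.+1)%N -> deg m x ->
  (forall i j a b, (d <= i)%N -> (d <= j)%N -> (i + j < n.+1)%N ->
     deg i a -> deg j b -> f a * g b = 0) -> convby D f g x = 0.
Proof.
move=> Dd lf lg mn dx fg.
apply: (@tdeg_ext _ (tpair f g) (fun=> 0)) (Dd _ dx) _.
- exact: tpair_linear.
- exact: linear_zero.
- by move=> i j a b di dj ij da db; rewrite tpairE// (fg i j)// ij.
Qed.

(** Both tensor factors of the half-coproduct have degree at least 1, so [g] is evaluated in degree
    strictly below the total degree. *)
Lemma hprec_raising f : linear f -> raising (hprec f).
Proof.
move=> lf; split=> [g lg|g h lg lh|n g lg gn].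
- exact: hprec_linear.
- by apply/eqP; rewrite eq_sym subr_eq -hprecDr// ?subrK//; lin.
case=> [|m] x mn dx.
  by have [c ->] := deg0P dx; rewrite linearZP ?hprec1 ?scaler0//;
    exact: hprec_linear.
(* Here n is positive, so [g] vanishes in degree 0 and the extension term g(1) f drops out. *)
have g1 : g 1 = 0 by apply: gn deg01; case: (n) mn.
rewrite hprecE fctE g1 mul0r addr0 (redfun_id g1).
apply: (convby_vanish _ (redfun_linear lf) lg mn dx) => [y dy|i j a b i0 j0 ij da db].
  exact: (ub_split_deg _ dy).1.
by rewrite (gn j) ?mulr0//; move: ij; rewrite ltnS;
  apply: leq_trans; rewrite -add1n leq_add2r.
Qed.

Lemma hsucc_raising f : linear f -> raising (hsucc^~ f).
Proof.
move=> lf; split=> [g lg|g h lg lh|n g lg gn].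
- exact: hsucc_linear.
- by apply/eqP; rewrite eq_sym subr_eq -hsuccDl// ?subrK//; lin.
case=> [|m] x mn dx.
  by have [c ->] := deg0P dx; rewrite linearZP ?hsucc1 ?scaler0//;
    exact: hsucc_linear.
have g1 : g 1 = 0 by apply: gn deg01; case: (n) mn.
rewrite hsuccE fctE g1 mul0r addr0 (redfun_id g1).
apply: (convby_vanish _ lg (redfun_linear lf) mn dx) => [y dy|i j a b i0 j0 ij da db].
  exact: (ub_split_deg _ dy).2.
by rewrite (gn i) ?mul0r//; move: ij; rewrite ltnS;
  apply: leq_trans; rewrite -addn1 leq_add2l.
Qed.

(** The full coproduct also has left factors of degree 0, and these are killed by f(1) = 0. *)
Lemma conv_raising f : linear f -> f 1 = 0 -> raising (conv f).
Proof.
move=> lf f1; split=> [g lg|g h lg lh|n g lg gn m x mn dx].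
- exact: conv_linear.
- by apply/eqP; rewrite eq_sym subr_eq -convDr// ?subrK//; lin.
apply: (convby_vanish _ lf lg mn dx) => [y|[|i] j a b _ _ ij da db].
- exact: ub_cop_deg.
- by have [c ->] := deg0P da; rewrite linearZP// f1 scaler0 mul0r.
- by rewrite (gn j) ?mulr0//; move: ij; rewrite ltnS;
  apply: leq_trans; rewrite addSn ltnS leq_addl.
Qed.

Lemma conv_right_inverse f : linear f -> f 1 = 1 ->
  exists2 g, linear g & conv f g = augm.
Proof.
move=> lf f1; have la := augm_linear.
have lu : linear (augm - f) by lin.
have u1 : (augm - f) 1 = 0 by rewrite !fctE augm1 f1 subrr.
have ru := conv_raising lu u1; have lg := geom_linear ru.
(* g = e + (e - f) * g amounts to f * g = e *)
exists (geom (conv (augm - f))) => //.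
have := geom_fix ru; set g := geom _ in lg *.
have -> : conv (augm - f) g = g - conv f g.
  apply/eqP; rewrite eq_sym subr_eq -convDl//.
  by rewrite subrK conv_augml.
by rewrite addrCA -{1}[g]addr0 => /addrI/esym/subr0_eq/esym.
Qed.

Lemma conv_left_inverse_eq f g h : linear f -> linear g -> linear h ->
  conv g f = augm -> conv f h = augm -> g = h.
Proof.
by move=> lf lg lh gf fh; rewrite -(conv_augmr lg) -fh convA// gf conv_augml.
Qed.

(** * The half-shuffle exponentials as unique fixed points *)

Lemma EprecE f : linear f -> f 1 = 0 -> Eprec f = geom (hprec f).
Proof.
move=> lf f1; apply/funext => x; congr +%R; apply: eq_fsbigr => -[|n].
  by rewrite inE.
(* As f ≺ e = f, the power of index n + 1, which iterates n times from f, is the iterate n + 1 times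
   from e. *)
by move=> _; rewrite /precpow iterSr hprec_augmr.
Qed.

Lemma EsuccE f : linear f -> f 1 = 0 -> Esucc f = geom (hsucc^~ f).
Proof.
move=> lf f1; apply/funext => x; congr +%R; apply: eq_fsbigr => -[|n].
  by rewrite inE.
by move=> _; rewrite /succpow iterSr hsucc_augml.
Qed.

Lemma Eprec_linear f : linear f -> f 1 = 0 -> linear (Eprec f).
Proof. by move=> lf f1; rewrite EprecE//; apply/geom_linear/hprec_raising. Qed.

Lemma Esucc_linear f : linear f -> f 1 = 0 -> linear (Esucc f).
Proof. by move=> lf f1; rewrite EsuccE//; apply/geom_linear/hsucc_raising. Qed.

Lemma Eprec_fix f : linear f -> f 1 = 0 -> Eprec f = augm + hprec f (Eprec f).
Proof. by move=> lf f1; rewrite EprecE//; exact/geom_fix/hprec_raising. Qed.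

Lemma Esucc_fix f : linear f -> f 1 = 0 -> Esucc f = augm + hsucc (Esucc f) f.
Proof. by move=> lf f1; rewrite EsuccE//; exact: (geom_fix (hsucc_raising lf)). Qed.

Lemma Eprec_unique f g : linear f -> f 1 = 0 -> linear g ->
  g = augm + hprec f g -> g = Eprec f.
Proof.
move=> lf f1 lg gE; apply: (raising_unique (hprec_raising lf)) gE _ => //.
  exact: Eprec_linear.
exact: Eprec_fix.
Qed.

Lemma Esucc_unique f g : linear f -> f 1 = 0 -> linear g ->
  g = augm + hsucc g f -> g = Esucc f.
Proof.
move=> lf f1 lg gE; apply: (raising_unique (hsucc_raising lf)) gE _ => //.
  exact: Esucc_linear.
exact: Esucc_fix.
Qed.

Lemma Eprec1 f : linear f -> f 1 = 0 -> Eprec f 1 = 1.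
Proof.
move=> lf f1; rewrite Eprec_fix// fctE hprec1 ?augm1 ?addr0//.
exact: Eprec_linear.
Qed.

(** * The two exponentials as mutual inverses *)

Lemma conv_hprec_hsucc_l f g : linear f -> linear g -> f 1 = 0 ->
  conv f g = hprec f g + hsucc f g.
Proof.
move=> lf lg f1; rewrite conv_hprec_hsucc// f1.
by apply/funext => x; rewrite !fctE !mul0r addr0.
Qed.

Lemma conv_hprec_hsucc_r f g : linear f -> linear g -> g 1 = 0 ->
  conv f g = hprec f g + hsucc f g.
Proof.
move=> lf lg g1; rewrite conv_hprec_hsucc// g1.
by apply/funext => x; rewrite !fctE mulr0 mul0r addr0.
Qed.

Lemma hprec_oppl f g : linear f -> linear g -> hprec (- f) g = - hprec f g.
Proof.
move=> lf lg; apply/eqP; rewrite -addr_eq0 -hprecDl//; last by lin.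
rewrite addNr hprecE redfun_id ?convby0l//; last exact: redfun_linear.
by apply/eqP/funext => x; rewrite !fctE mulr0 addr0.
Qed.

Lemma hsucc_oppr f g : linear f -> linear g -> hsucc f (- g) = - hsucc f g.
Proof.
move=> lf lg; apply/eqP; rewrite -addr_eq0 -hsuccDr//; last by lin.
rewrite addNr hsuccE (@redfun_id 0) ?convby0r//; last exact: redfun_linear.
by apply/eqP/funext => x; rewrite !fctE mulr0 addr0.
Qed.

(** Write X = e - w with w = f ≺ X, and Y = e + s with s = Y ≻ f. Then Y * X = X + s ≺ X + s ≻ X,
    where s ≺ X = Y ≻ w = w + s ≻ w and s ≻ X = - s ≻ w, so the sum is X + w = e. *)
Lemma conv_Esucc_Eprec f : linear f -> f 1 = 0 ->
  conv (Esucc f) (Eprec (- f)) = augm.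
Proof.
move=> lf f1; have lN : linear (- f) by lin.
have N1 : (- f) 1 = 0 by rewrite fctE f1 oppr0.
have la := augm_linear.
have lX := Eprec_linear lN N1; have lY := Esucc_linear lf f1.
set X := Eprec (- f) in lX *; set Y := Esucc f in lY *.
have lP := hprec_linear lf lX; have lS := hsucc_linear lY lf.
have XE : X = augm - hprec f X by rewrite {1}/X Eprec_fix// hprec_oppl.
have YE : Y = augm + hsucc Y f by rewrite {1}/Y Esucc_fix.
rewrite {1}YE convDl// conv_augml// conv_hprec_hsucc_l// ?hsucc1//.
rewrite hprec_hsuccA//; set s := hsucc Y f in lS YE *.
set w := hprec f X in lP XE *.
have -> : hsucc s X = - hsucc s w.
  by rewrite XE hsuccDr//; [rewrite hsucc_augmr// add0r hsucc_oppr|lin].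
rewrite YE hsuccDl// hsucc_augml//; last exact: hprec1.
by rewrite addrK XE subrK.
Qed.

(** A right inverse exists because the exponential is 1 at 1, and it must equal the left inverse
    already found. *)
Lemma conv_Eprec_Esucc f : linear f -> f 1 = 0 ->
  conv (Eprec (- f)) (Esucc f) = augm.
Proof.
move=> lf f1; have lN : linear (- f) by lin.
have N1 : (- f) 1 = 0 by rewrite fctE f1 oppr0.
have lX := Eprec_linear lN N1; have lY := Esucc_linear lf f1.
have [Z lZ XZ] := conv_right_inverse lX (Eprec1 lN N1).
by rewrite (conv_left_inverse_eq lX lY lZ (conv_Esucc_Eprec lf f1) XZ).
Qed.

Lemma cinv_Eprec_opp f : linear f -> f 1 = 0 -> cinv (Eprec (- f)) = Esucc f.
Proof.
(* Any inverse that [xget] picks equals [Esucc f] by uniqueness; the default 0 is ruled out because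
   [Esucc f] is itself an inverse. *)
move=> lf f1; rewrite /cinv; case: xgetP => [g -> [lg [Xg gX]]|/(_ (Esucc f))].
  have lN : linear (- f) by lin.
  have N1 : (- f) 1 = 0 by rewrite fctE f1 oppr0.
  apply: conv_left_inverse_eq (Eprec_linear lN N1) lg (Esucc_linear lf f1) gX _.
  exact: conv_Eprec_Esucc.
case; split; first exact: Esucc_linear.
by rewrite conv_Eprec_Esucc// conv_Esucc_Eprec.
Qed.

Lemma adprec_opp f g : linear f -> f 1 = 0 ->
  adprec (- f) g = hprec (hsucc (Esucc f) g) (Eprec (- f)).
Proof. by move=> lf f1; rewrite /adprec cinv_Eprec_opp. Qed.

(** * The two product formulas *)

Lemma conv_Eprec_adprec f g : linear f -> f 1 = 0 -> linear g -> g 1 = 0 ->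
  conv (Eprec f) (Eprec (adprec f g)) = Eprec (f + g).
Proof.
move=> lf f1 lg g1; rewrite -[f in adprec f]opprK.
have la := augm_linear; have lN : linear (- f) by lin.
have N1 : (- f) 1 = 0 by rewrite fctE f1 oppr0.
rewrite adprec_opp// opprK.
have lX := Eprec_linear lf f1; have lY := Esucc_linear lN N1.
have XY : conv (Eprec f) (Esucc (- f)) = augm.
  by rewrite -[f in Eprec f]opprK conv_Eprec_Esucc.
have XE := Eprec_fix lf f1.
set X := Eprec f in lX XY XE *; set Y := Esucc _ in lY XY *.
have lYg := hsucc_linear lY lg; have lb := hprec_linear lYg lX.
have b1 := hprec1 lYg lX.
set b := hprec (hsucc Y g) X in lb b1 *.
have lZ := Eprec_linear lb b1; have ZE := Eprec_fix lb b1.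
set Z := Eprec b in lZ ZE *; have lXZ := conv_linear lX lZ.
have lfX := hprec_linear lf lX; have lgX := hprec_linear lg lX.
have lbZ := hprec_linear lb lZ.
(* Rebracketed, b is Y ≻ (g ≺ X), and X * Y = e absorbs the outer factor. *)
have Xb : hsucc X b = hprec g X.
  by rewrite /b hprec_hsuccA// hsuccA ?hprec1// XY hsucc_augml// hprec1.
apply: Eprec_unique => //; first by lin.
  by rewrite fctE f1 g1 addr0.
rewrite hprecDl// -!hprecA//.
rewrite {1}ZE convDr// conv_augmr// conv_hprec_hsucc_r//; last exact: hprec1.
rewrite -hprec_hsuccA// Xb [LHS]addrA [RHS]addrA; congr (_ + _).
(* There remains X + X ≺ (b ≺ Z) = e + (f ≺ X) ≺ Z. Since e ≺ (b ≺ Z) = 0, it follows by expanding X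
   on the left and Z on the right. *)
rewrite {1 2}XE -addrA; congr +%R.
rewrite hprecDl// hprec_augml// add0r [in RHS]ZE hprecDr//.
by rewrite hprec_augmr// hprec1.
Qed.

(** Mirror argument with Y = E_≻(g), X = E_≺(- g) its inverse, b = Y ≻ f ≺ X and Z = E_≻(b): now b ≺
    Y = Y ≻ f, and Z * Y solves the equation W = e + W ≻ (f + g). *)
Lemma conv_Esucc_adprec f g : linear f -> f 1 = 0 -> linear g -> g 1 = 0 ->
  conv (Esucc (adprec (- g) f)) (Esucc g) = Esucc (f + g).
Proof.
move=> lf f1 lg g1; rewrite adprec_opp//.
have la := augm_linear; have lN : linear (- g) by lin.
have N1 : (- g) 1 = 0 by rewrite fctE g1 oppr0.
have lX := Eprec_linear lN N1; have lY := Esucc_linear lg g1.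
have XY := conv_Eprec_Esucc lg g1; have YE := Esucc_fix lg g1.
set X := Eprec _ in lX XY *; set Y := Esucc _ in lY XY YE *.
have lYf := hsucc_linear lY lf; have Yf1 := hsucc1 lY lf.
have lb := hprec_linear lYf lX; have b1 := hprec1 lYf lX.
have bY : hprec (hprec (hsucc Y f) X) Y = hsucc Y f.
  by rewrite hprecA// XY hprec_augmr.
set b := hprec _ X in lb b1 bY *.
have lZ := Esucc_linear lb b1; have ZE := Esucc_fix lb b1.
set Z := Esucc b in lZ ZE *; have lZY := conv_linear lZ lY.
have lZb := hsucc_linear lZ lb; have lYg := hsucc_linear lY lg.
apply: Esucc_unique => //; first by lin.
  by rewrite fctE f1 g1 addr0.
rewrite hsuccDr// -!hsuccA//.
rewrite {1}ZE convDl// conv_augml// conv_hprec_hsucc_l//; last exact: hsucc1.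
(* The summand (Z ≻ b) ≺ Y = Z ≻ (b ≺ Y) = Z ≻ (Y ≻ f) is the contribution of f; what remains is Y +
   (Z ≻ b) ≻ Y = e + Z ≻ (Y ≻ g). *)
rewrite hprec_hsuccA// bY addrCA [RHS]addrCA; congr (_ + _).
rewrite {1 2}YE -addrA; congr +%R.
rewrite [in RHS]ZE hsuccDl// hsucc_augml ?hsucc1//; congr +%R.
by rewrite hsuccDr// hsucc_augmr// add0r.
Qed.

End Bialgebra.

Theorem theorem31 (k : fieldType) (hk : [pchar k]%R =i pred0)
    (B : unshuffle_bialgebra k) (A : comAlgType k) (gamma1 gamma2 : B -> A) :
  inf_character gamma1 -> inf_character gamma2 ->
  conv (Eprec gamma1) (Eprec (adprec gamma1 gamma2)) = Eprec (gamma1 + gamma2)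
  /\
  conv (Esucc (adprec (- gamma2) gamma1)) (Esucc gamma2)
    = Esucc (gamma1 + gamma2).
Proof.
move=> [l1 e1 _] [l2 e2 _].
by split; [exact: conv_Eprec_adprec|exact: conv_Esucc_adprec].
Qed.
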